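(* Let $\Gamma$ be an arbitrary group generated by a finite symmetric set $S=S^{-1}\subset\Gamma$, with growth function $\gamma_S$. Then for every finite non-empty subset $D\subset\Gamma$, $$\frac{|\partial_S D|}{|D|}\ \ge\ \sup_{r\in\mathbb{N}}\left(\frac{\gamma_S(r)-|D|}{r\,\gamma_S(r)-\sum_{k=0}^{r-1}\gamma_S(k)}\right).$$
   Context: Here $\mathbb{N}=\{1,2,3,\dots\}$. For an integer $r\ge 0$, $B_S(r)\subset\Gamma$ is the set of elements that can be written as a product of at most $r$ elements of $S$ (so $B_S(0)=\{e\}$), and $\gamma_S(r)=|B_S(r)|$, where $|\cdot|$ denotes cardinality. The (inner) boundary of $D\subset\Gamma$ is $\partial_S D=\{x\in D : \exists s\in S \text{ such that } sx\notin D\}$. *)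

(* Defs.v *)
From HB Require Import structures.
From mathcomp Require Import all_boot all_order all_algebra.
From mathcomp Require Import finmap.
From mathcomp Require Import all_classical all_reals.

Set Implicit Arguments.
Unset Strict Implicit.
Unset Printing Implicit Defensive.

Local Open Scope fset_scope.
Local Open Scope classical_set_scope.
Local Open Scope group_scope.

Definition symmetric_fset (G : groupType) (S : {fset G}) : Prop :=
  [fset s^-1 | s in S] = S.

Definition generates (G : groupType) (S : {fset G}) : Prop :=
  smallest [set H : set G | group_closed (mem H)] [set` S] = setT.

Definition word_ball (G : groupType) (S : {fset G}) (r : nat) : set G :=
  [set g | exists w : seq G,
    [/\ (size w <= r)%N, {subset w <= S} & g = \prod_(s <- w) s]].

(* [fset_set] is meaningful on balls only because they are finite. *)
Lemma finite_word_ball (G : groupType) (S : {fset G}) (r : nat) :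
  finite_set (word_ball S r).
Proof.
elim: r => [|r IHr].
  apply: (sub_finite_set _ (finite_set1 1)) => _ [w [+ _ ->]].
  by rewrite leqn0 => /nilP ->; rewrite big_nil.
have fin : finite_set
    ([set 1] `|` [set s * g | s in [set` S] & g in word_ball S r]).
  rewrite finite_setU; split; first exact: finite_set1.
  by apply: finite_image2 => //; exact: finite_fset.
apply: (sub_finite_set _ fin) => _ [[|s w] [+ wS ->]].
  by rewrite big_nil => _; left.
rewrite big_cons => lew; right; exists s; first exact/wS/mem_head.
exists (\prod_(t <- w) t) => //; exists w; split=> // t tw.
by apply: wS; rewrite inE tw orbT.
Qed.

Definition growth (G : groupType) (S : {fset G}) (r : nat) : nat :=
  #|` fset_set (word_ball S r)|.

Definition inner_boundary (G : groupType) (S D : {fset G}) : {fset G} :=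
  [fset x in D | [exists s : S, (val s * x) \notin D]].

(* Main.v *)
(** For [g] in [G] let [m g] be the number of [d] in [D] with [g d] outside [D].
    If [g] has word length [n], following the orbit of [d] along a word for [g]
    shows that each such [d] leaves [D] through a boundary point at one of [n]
    steps, so [m g <= n * #|boundary|]. Summing over the ball of radius [r],
    layer by layer, bounds the total by
    [#|boundary| * (r * growth r - \sum_(k < r) growth k)]. On the other hand
    each [d] is kept inside [D] by at most [#|D|] elements [g], so the same total
    is at least [#|D| * (growth r - #|D|)]. *)

Require Import Defs.
From mathcomp Require Import all_boot all_order all_algebra.
From mathcomp Require Import finmap zify lra.
From mathcomp Require Import all_classical all_reals ereal.

Local Open Scope fset_scope.
Local Open Scope classical_set_scope.
Local Open Scope ring_scope.

Import Order.TTheory GRing.Theory Num.Theory.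

Lemma leq_card_inj (T T' : choiceType) (f : T -> T') (A : {fset T})
    (B : {fset T'}) :
  injective f -> (forall x, x \in A -> f x \in B) -> (#|` A| <= #|` B|)%N.
Proof.
move=> f_inj fAB; have <- : #|` (f @` A)%fset| = #|` A| by exact: card_imfset.
by apply/fsubset_leq_card/fsubsetP => _ /imfsetP[x xA ->]; exact: fAB.
Qed.

Section Displacement.
Variables (G : groupType) (S D : {fset G}).

(** Its cardinality is the count [m g] described above. *)
Definition displaced (g : G) : {fset G} := [fset d in D | (g * d)%g \notin D].

Lemma displaced1 : displaced 1 = fset0.
Proof.
by apply/fsetP => d; rewrite !inE mul1g; case: (d \in D).
Qed.

(** If [s * h] moves [d] out of [D] but [h] does not, then [h * d] lies in [D] and [s] pushes it
    out, so it is a boundary point; left translation by [h] is injective. *)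
Lemma card_displacedM (s h : G) : s \in S ->
  (#|` displaced (s * h)%g| <= #|` displaced h| + #|` inner_boundary S D|)%N.
Proof.
move=> sS; pose E := [fset d in D | (h * d)%g \in inner_boundary S D].
apply: (@leq_trans #|` (displaced h `|` E)%fset|).
  apply/fsubset_leq_card/fsubsetP => d; rewrite !inE -mulgA.
  case/andP=> -> /= shd; case: (boolP (_ \in D)) => //= hd.
  by apply/existsP; exists [` sS].
rewrite (leq_trans (leq_card_fsetU _ _)) // leq_add2l.
by apply: leq_card_inj (mulgI h) _ => d /[!inE] /andP[_ hd]; rewrite hd.
Qed.

Lemma card_displaced_ball (g : G) (r : nat) : word_ball S r g ->
  (#|` displaced g| <= r * #|` inner_boundary S D|)%N.
Proof.
case=> w [lewr wS ->]; apply: (@leq_trans (size w * #|` inner_boundary S D|)).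
  elim: w wS {lewr} => [|s w IHw] wS; first by rewrite big_nil displaced1 cardfs0.
  rewrite big_cons mulSn addnC.
  apply: leq_trans (card_displacedM _ _ (wS s (mem_head _ _))) _.
  by rewrite leq_add2r IHw // => t tw; rewrite wS // inE tw orbT.
by rewrite leq_mul2r lewr orbT.
Qed.

Let ball r := fset_set (word_ball S r).

Lemma mem_ball r g : reflect (word_ball S r g) (g \in ball r).
Proof.
by rewrite in_fset_set ?inE; [apply: asboolP | exact: finite_word_ball].
Qed.

Lemma ball_sub r : (ball r `<=` ball r.+1)%fset.
Proof.
apply/fsubsetP => g /mem_ball[w [lewr wS ->]].
by apply/mem_ball; exists w; split=> //; exact: leqW.
Qed.

(** Balls are nested, so the denominator of the theorem is nonnegative. *)
Lemma sum_growth_le r : (\sum_(0 <= k < r) growth S k <= r * growth S r)%N.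
Proof.
elim: r => [|r IHr]; first by rewrite big_geq.
rewrite big_nat_recr //= mulSn addnC.
have le_growth := fsubset_leq_card (ball_sub r).
by rewrite leq_add // (leq_trans IHr) // leq_mul2l le_growth orbT.
Qed.

(** The growth sum stands on the left to avoid truncated subtraction. Passing from [r] to [r.+1]
    adds one sphere, whose elements each displace at most [r.+1] times the boundary size. *)
Lemma sum_displaced_le r :
  (\sum_(g <- ball r) #|` displaced g|
     + #|` inner_boundary S D| * \sum_(0 <= k < r) growth S k
   <= #|` inner_boundary S D| * (r * growth S r))%N.
Proof.
elim: r => [|r IHr].
  rewrite big_geq // !muln0 addn0 big_seq big1 // => g /mem_ball gB.
  apply/eqP; rewrite -leqn0 -(mul0n #|` inner_boundary S D|).
  exact: card_displaced_ball.
rewrite big_nat_recr //=.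
have cardE : growth S r.+1 = (growth S r + #|` (ball r.+1 `\` ball r)%fset|)%N.
  by rewrite -[LHS](cardfsID (ball r)) (fsetIidPr (ball_sub r)).
rewrite (big_fsetID _ (mem (ball r))) /=.
have -> : [fset x in ball r.+1 | x \in ball r] = ball r.
  by rewrite -[RHS](fsetIidPr (ball_sub r)); apply/fsetP => x; rewrite !inE.
have -> : [fset x in ball r.+1 | x \notin ball r] = (ball r.+1 `\` ball r)%fset.
  by apply/fsetP => x; rewrite !inE andbC.
have new : (\sum_(g <- (ball r.+1 `\` ball r)%fset) #|` displaced g|
     <= #|` (ball r.+1 `\` ball r)%fset| * (r.+1 * #|` inner_boundary S D|))%N.
  rewrite card_fset_sum1 big_distrl /= big_seq [leqRHS]big_seq.
  apply: leq_sum => g; rewrite inE mul1n => /andP[_ /mem_ball].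
  exact: card_displaced_ball.
(* With [n] the size of the sphere, the two bounds fit exactly:
   [r.+1 * (c + n) = r * c + c + r.+1 * n]. *)
rewrite cardE; move: IHr new.
set n := #|` (_ `\` _)%fset|; set b := #|` inner_boundary S D|; set c := growth S r.
set t := (\sum_(0 <= k < r) _)%N; set x := (\sum_(g <- ball r) _)%N.
set y := (\sum_(g <- _) _)%N; lia.
Qed.

Lemma sum_displaced_ge (B : {fset G}) :
  (#|` B| * #|` D| <= \sum_(g <- B) #|` displaced g| + #|` D| * #|` D|)%N.
Proof.
(* Right translation by [d] injects the [g] in [B] that keep [d] inside [D] into [D]. *)
have kept d : (#|` B| <= \sum_(g <- B) ((g * d)%g \notin D) + #|` D|)%N.
  rewrite card_fset_sum1 (bigID (fun g => (g * d)%g \notin D)) /=.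
  rewrite [X in (X + _)%N]big_mkcond leq_add //.
  rewrite big_fset_condE -card_fset_sum1.
  by apply: leq_card_inj (mulIg d) _ => g /[!inE] /andP[_ /negPn].
have -> : (\sum_(g <- B) #|` displaced g| =
    \sum_(d <- D) \sum_(g <- B) ((g * d)%g \notin D))%N.
  rewrite exchange_big; apply: eq_bigr => g _.
  rewrite card_fset_sum1 big_fset big_mkcond /=.
  by apply: eq_bigr => d _; case: ifP.
rewrite mulnC [X in (X * _ <= _)%N]card_fset_sum1.
rewrite [X in (_ <= _ + X * _)%N]card_fset_sum1 !big_distrl -big_split /=.
by apply: leq_sum => d _; rewrite !mul1n.
Qed.

End Displacement.

(* A vanishing denominator forces G to be trivial; the term is then 0/0 = 0. *)
Theorem theorem3p6 (R : realType) (G : groupType) (S : {fset G})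
    (symS : symmetric_fset S) (genS : generates S)
    (D : {fset G}) (D0 : D != fset0) :
  (ereal_sup
     [set (((growth S r)%:R - #|` D|%:R)
             / (r%:R * (growth S r)%:R - \sum_(0 <= k < r) (growth S k)%:R)
           : R)%:E
     | r in [set r : nat | (1 <= r)%N]]
   <= (#|` inner_boundary S D|%:R / #|` D|%:R : R)%:E)%E.
Proof.
apply: ge_ereal_sup => _ [r _ <-]; rewrite lee_fin.
have := sum_displaced_le _ S D r.
have := sum_displaced_ge _ D (fset_set (word_ball S r)).
rewrite -/(growth S r).
set d := #|` D|; set b := #|` inner_boundary S D|; set c := growth S r.
set m := (\sum_(g <- _) _)%N; rewrite -natr_sum.
set t := (\sum_(0 <= k < r) _)%N => lower upper.
have d0 : 0 < d%:R :> R by rewrite ltr0n cardfs_gt0.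
have tle : t%:R <= r%:R * c%:R :> R.
  by rewrite -natrM ler_nat sum_growth_le.
have [->|den] := eqVneq (r%:R * c%:R - t%:R : R) 0.
  by rewrite invr0 mulr0 divr_ge0.
have den0 : 0 < r%:R * c%:R - t%:R :> R by rewrite lt_neqAle eq_sym den subr_ge0.
rewrite ler_pdivrMr // mulrAC ler_pdivlMr //.
(* Eliminating the total displacement [m] between the two bounds gives the goal with denominators
   cleared. *)
have : (c * d + b * t <= b * (r * c) + d * d)%N by lia.
rewrite -(ler_nat R) !natrD !natrM; lra.
Qed.
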